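(* Let $k\ge 1$ and $n\ge 1$ be integers, let $S\subseteq\{1,\dots,k\}$ with $d=|S|$, and let $\lambda$ be a partition. If $k\notin S$, the number of large $(k,S)$-Fuss-Schröder paths of length $n$ and type $\lambda$ is \[ \frac{1}{n}\frac{|\lambda|}{kn+1}\binom{dn}{n-|\lambda|}\binom{kn+1}{\ell(\lambda)}\frac{\ell(\lambda)!}{m_\lambda}. \] If $k\in S$, the number of small $(k,S)$-Fuss-Schröder paths of length $n$ and type $\lambda$ is the same quantity \[ \frac{1}{n}\frac{|\lambda|}{kn+1}\binom{dn}{n-|\lambda|}\binom{kn+1}{\ell(\lambda)}\frac{\ell(\lambda)!}{m_\lambda}; \] the number of large $(k,S)$-Fuss-Schröder paths of length $n$ and type $\lambda$ ending in a diagonal step is \[ \frac{1}{n}\binom{dn}{n-1-|\lambda|}\binom{kn}{\ell(\lambda)}\frac{\ell(\lambda)!}{m_\lambda}; \] and the total number of large $(k,S)$-Fuss-Schröder paths of length $n$ and type $\lambda$ is \[ \frac{1}{n} \left(\binom{dn}{n-1-|\lambda|}+\frac{|\lambda|}{kn+1}\binom{dn+1}{n-|\lambda|}\right)\binom{kn+1}{\ell(\lambda)}\frac{\ell(\lambda)!}{m_\lambda}. \]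
   Context: For a partition $\lambda$ (possibly empty), $\ell(\lambda)$ is its number of parts, $|\lambda|$ the sum of its parts, $m_i(\lambda)$ the number of parts equal to $i$, and $m_\lambda=m_1(\lambda)!\,m_2(\lambda)!\,m_3(\lambda)!\cdots$. Binomial coefficients $\binom{a}{b}$ with $b<0$ or $b>a\ge 0$ are $0$. For $S\subseteq\{1,\dots,k\}$, a large $(k,S)$-Fuss-Schröder path of length $n$ is a lattice path from $(0,0)$ to $(n,kn)$ using east steps $(1,0)$, north steps $(0,1)$ and diagonal steps $(1,1)$, which never crosses below the line $y=kx$, and such that each diagonal step goes from the line $y=kj+r-1$ to the line $y=kj+r$ for some integer $j$ and some $r\in S$. It is small if no diagonal step touches the line $y=kx$. The type of such a path is the partition whose parts are the lengths of the maximal runs of consecutive east steps in the path. *)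

(* Defs.v *)
From HB Require Import structures.
From mathcomp Require Import all_boot all_order all_algebra.
From mathcomp Require Import finmap.

Set Implicit Arguments.
Unset Strict Implicit.
Unset Printing Implicit Defensive.

Import Order.TTheory GRing.Theory Num.Theory.

Inductive step := East | North | Diag.

Definition option_of_step (s : step) : option bool :=
  match s with East => Some true | North => Some false | Diag => None end.

Definition step_of_option (o : option bool) : step :=
  match o with Some true => East | Some false => North | None => Diag end.

Lemma option_of_stepK : cancel option_of_step step_of_option.
Proof. by case. Qed.

HB.instance Definition _ := Countable.copy step (can_type option_of_stepK).
HB.instance Definition _ : isFinite step := CanIsFinite option_of_stepK.

Definition move (v : nat * nat) (s : step) : nat * nat :=
  match s with
  | East => (v.1.+1, v.2)
  | North => (v.1, v.2.+1)
  | Diag => (v.1.+1, v.2.+1)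
  end.

Definition endpoint (w : seq step) : nat * nat := foldl move (0, 0) w.

(* All lattice points visited by the path, starting point included. *)
Definition vertices (w : seq step) : seq (nat * nat) :=
  (0, 0) :: scanl move (0, 0) w.

(* The i-th step starts at the i-th vertex; [zip] drops the endpoint. *)
Definition diag_starts (w : seq step) : seq (nat * nat) :=
  [seq a.1 | a <- zip (vertices w) w & a.2 == Diag].

(* [y = k j + r - 1] for some integer [j] and some [r] in [S], written as a
   congruence modulo [k]; see [diag_levelP]. *)
Definition diag_level (k : nat) (S : {fset nat}) (y : nat) : bool :=
  [exists r : S, y.+1 == val r %[mod k]].

Lemma diag_levelP k (S : {fset nat}) y :
  reflect (exists2 r, r \in S &
             exists j : int, (y%:Z = k%:Z * j + r%:Z - 1)%R)
          (diag_level k S y).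
Proof.
have cong r : (y.+1 == r %[mod k]) = (k%:Z %| (y.+1%:Z - r%:Z)%R)%Z.
  by rewrite -eqz_mod_dvd !modz_nat eqz_nat.
apply: (iffP existsP) => [[r] | [r rS [j def_y]]].
  rewrite cong => /dvdzP[j def_j]; exists (val r); first exact: valP.
  by exists j; rewrite mulrC -def_j subrK -addn1 PoszD addrK.
exists [` rS]%fset; rewrite cong; apply/dvdzP; exists j.
by rewrite /= -addn1 PoszD def_y subrK addrK mulrC.
Qed.

(* A path is never below [y = k x] iff none of its vertices is. *)
Definition large_path (k : nat) (S : {fset nat}) (n : nat) (w : seq step) :
    bool :=
  [&& endpoint w == (n, k * n),
      all (fun v => k * v.1 <= v.2) (vertices w)
    & all (fun v => diag_level k S v.2) (diag_starts w)].

Definition on_line (k : nat) (v : nat * nat) : bool := v.2 == k * v.1.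

(* As the path is weakly above the line, a diagonal step meets the line iff one
   of its two ends lies on it. *)
Definition small_path (k : nat) (S : {fset nat}) (n : nat) (w : seq step) :
    bool :=
  large_path k S n w &&
  all (fun v => ~~ on_line k v && ~~ on_line k (move v Diag)) (diag_starts w).

Definition ends_diag (w : seq step) : bool := last East w == Diag.

(* Lengths of the consecutive runs of east steps separated by the other steps,
   zeros included; [c] is the length of the current run. *)
Fixpoint east_runs (c : nat) (w : seq step) : seq nat :=
  match w with
  | [::] => [:: c]
  | East :: w' => east_runs c.+1 w'
  | _ :: w' => c :: east_runs 0 w'
  end.

Definition path_type (w : seq step) : seq nat :=
  sort geq [seq r <- east_runs 0 w | 0 < r].

Definition is_partition (lam : seq nat) : bool :=
  sorted geq lam && (0 \notin lam).

(* The product of the [m_i(lam)!]; values [i] outside [lam] contribute [0!]. *)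
Definition mult_fact (lam : seq nat) : nat :=
  \prod_(i <- undup lam) (count_mem i lam)`!.

(* Binomial coefficient vanishing for a negative lower index. *)
Definition binz (a : nat) (b : int) : nat :=
  match b with Posz m => 'C(a, m) | Negz _ => 0 end.

(* Each step increases [x] or [y], so a path to [(n, k n)] has at most
   [n + k n] steps (see [large_path_size]) and the count below misses none. *)
Definition num_paths (k n : nat) (P : pred (seq step)) : nat :=
  #|[set w : (n + k * n).-bseq step | P w]|.

Lemma size_le_endpoint (w : seq step) (v : nat * nat) :
  size w + (v.1 + v.2) <= (foldl move v w).1 + (foldl move v w).2.
Proof.
elim: w v => //= s w IHw v; apply: leq_trans (IHw _); rewrite addSnnS leq_add2l.
by case: s => /=; rewrite ?addSn ?addnS.
Qed.

Lemma large_path_size k S n w : large_path k S n w -> size w <= n + k * n.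
Proof.
case/and3P=> /eqP def_end _ _; have := size_le_endpoint w (0, 0).
by rewrite -/(endpoint w) def_end !addn0.
Qed.

(* Main.v *)
Require Import Defs.
From mathcomp Require Import all_boot all_order all_algebra.
From mathcomp Require Import finmap.
From mathcomp Require Import zify ring.

(** A path has [k n] non-east steps, each followed by a possibly empty run of
    east steps. Cut the paths just before a non-east step and count the prefixes
    with [y] non-east steps, [m] of them diagonal, and run content [mu]: Lagrange
    inversion suggests the coefficient of [z ^ (|mu| + m)] in
    [P ^ (y + 1) (1 + z) ^ c (1 - k z P' / P - d z / (1 + z))], where
    [P = 1 + \sum_i p_i z ^ i] and [c] is the number of rows up to [y] allowing a
    diagonal step, the row [0] being included when [k \in S] and diagonal steps
    may touch the line. Adding one row multiplies this series by [P], or by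
    [P (1 + z)], which is the transition for unconstrained paths. The line
    [y = k x] only matters when [y + 1 = k x], where the forbidden contribution
    is the coefficient of [z ^ x] in [phi ^ x (1 - z phi' / phi)], with
    [phi = P ^ k (1 + z) ^ d], and that coefficient is zero. The closed form thus
    holds by induction on [y], and the theorem is the case [y = k n], or
    [y = k n - 1] for paths ending in a diagonal step. *)

Set Implicit Arguments.
Unset Strict Implicit.
Unset Printing Implicit Defensive.

Import Order.TTheory GRing.Theory Num.Theory.

Local Open Scope ring_scope.

(** * The closed form and its recurrences *)

Lemma mult_fact_widen (s mu : seq nat) :
  uniq s -> {subset mu <= s} ->
  mult_fact mu = (\prod_(i <- s) (count_mem i mu)`!)%N.
Proof.
move=> s_uniq mu_s; rewrite (bigID (mem mu)) /= [X in (_ * X)%N]big1; last first.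
  by move=> i /count_memPn->.
rewrite muln1 -big_filter; apply: perm_big; apply: uniq_perm.
- exact: undup_uniq.
- exact: filter_uniq.
by move=> i; rewrite mem_undup mem_filter andb_idr // => /mu_s.
Qed.

Lemma mult_fact_rem (j : nat) (mu : seq nat) :
  j \in mu -> mult_fact mu = (count_mem j mu * mult_fact (rem j mu))%N.
Proof.
move=> j_mu; have j_und: j \in undup mu by rewrite mem_undup.
rewrite (@mult_fact_widen (undup mu) (rem j mu)) ?undup_uniq //; last first.
  by move=> i /mem_rem; rewrite mem_undup.
rewrite /mult_fact !(bigD1_seq j) ?undup_uniq //= count_mem_rem eqxx.
have: (0 < count_mem j mu)%N by rewrite -has_count has_pred1.
case: (count_mem j mu) => // c _; rewrite subn1 factS -!mulnA; do 2!congr muln.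
apply: eq_bigr => i; rewrite count_mem_rem => /negPf.
by rewrite eq_sym => ->; rewrite subn0.
Qed.

Lemma mult_fact_gt0 (mu : seq nat) : (0 < mult_fact mu)%N.
Proof. by apply: prodn_gt0 => i; apply: fact_gt0. Qed.

(* The number of sequences of length [M] whose nonzero entries form [mu]. *)
Definition fillings (M : nat) (mu : seq nat) : rat :=
  (M ^_ size mu)%:R / (mult_fact mu)%:R.

Lemma sum_undup_count (mu : seq nat) (g : nat -> rat) :
  \sum_(j <- undup mu) (count_mem j mu)%:R * g j = \sum_(j <- mu) g j.
Proof.
rewrite -[RHS]big_undup_iterop_count; apply: eq_bigr => j _.
by rewrite -[iterop _ _ _ _]/(g j *+ _) mulr_natl.
Qed.

Lemma fillings_rem (M j : nat) (mu : seq nat) :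
  j \in mu ->
  fillings M (rem j mu)
  = (M ^_ (size mu).-1)%:R / (mult_fact mu)%:R * (count_mem j mu)%:R.
Proof.
move=> j_mu; rewrite /fillings size_rem // (mult_fact_rem j_mu) natrM.
have: (0 < count_mem j mu)%N by rewrite -has_count has_pred1.
have := mult_fact_gt0 (rem j mu).
by rewrite !lt0n -!(pnatr_eq0 rat) => m0 c0; field; rewrite m0 c0.
Qed.

Lemma sum_natr (mu : seq nat) : \sum_(j <- mu) j%:R = (sumn mu)%:R :> rat.
Proof. by rewrite sumnE natr_sum. Qed.

(** No bound on [l] is assumed: beyond [M] both falling factorials vanish, so the negative factor is
    harmless. *)
Lemma ffact_rec_rat (M l : nat) :
  (M ^_ l.+1)%:R = (M%:R - l%:R) * (M ^_ l)%:R :> rat.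
Proof.
rewrite ffactnSr natrM mulrC; case: (leqP l M) => [le_lM | lt_Ml].
  by rewrite natrB.
by rewrite [(M ^_ l)%N]ffact_small // !mulr0.
Qed.

(** Split by the last of the [M.+1] entries: it is 0, or a value [j] of [mu] that leaves [rem j mu]
    to the others. In series, this is [P ^ M * P]. *)
Lemma sum_fillings (M : nat) (mu : seq nat) :
  fillings M mu + \sum_(j <- undup mu) fillings M (rem j mu)
  = fillings M.+1 mu.
Proof.
rewrite (eq_big_seq (fun j => (count_mem j mu)%:R *
           ((M ^_ (size mu).-1)%:R / (mult_fact mu)%:R))); last first.
  by move=> j; rewrite mem_undup => /fillings_rem->; rewrite mulrC.
rewrite sum_undup_count big_tnth sumr_const card_ord -mulr_natr /fillings.
case: (size mu) => [|l] /=; first by rewrite !ffactn0; ring.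
by rewrite ffactSS natrM ffact_rec_rat -!natr1; ring.
Qed.

(** The weighted terms are the coefficients of [z P' P ^ (M - 1)], because [z (P ^ M)' / M]
    multiplies each coefficient of [P ^ M] by [|mu| / M]. The identity is multiplication by [P]. *)
Lemma sum_fillings_weighted (M : nat) (mu : seq nat) :
  (0 < M)%N ->
  (sumn mu)%:R / M%:R * fillings M mu
    + \sum_(j <- undup mu)
        (sumn mu - j)%:R / M%:R * fillings M (rem j mu)
  = (sumn mu)%:R / M.+1%:R * fillings M.+1 mu.
Proof.
move=> M_gt0; pose a : rat := (M ^_ (size mu).-1)%:R / (mult_fact mu)%:R.
rewrite (eq_big_seq (fun j => (count_mem j mu)%:R *
           (((sumn mu)%:R - j%:R) * (a / M%:R)))); last first.
  move=> j; rewrite mem_undup => j_mu; rewrite fillings_rem // -/a natrB.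
    by ring.
  by rewrite (perm_sumn (perm_to_rem j_mu)) leq_addr.
rewrite sum_undup_count -mulr_suml sumrB sum_natr big_tnth sumr_const card_ord.
rewrite -[_ *+ size mu]mulr_natr {}/a /fillings.
have M0: M%:R != 0 :> rat by rewrite pnatr_eq0 -lt0n.
have M1: M%:R + 1 != 0 :> rat by rewrite natr1 pnatr_eq0.
have m0: (mult_fact mu)%:R != 0 :> rat by rewrite pnatr_eq0 -lt0n mult_fact_gt0.
case: mu m0 => [|x mu] m0 /=; first by rewrite -natr1; field; rewrite M0 M1 m0.
rewrite ffactSS natrM ffact_rec_rat -!natr1.
by field; rewrite M0 M1 m0.
Qed.

(* Coefficient of [z ^ m] in [z (1 + z) ^ (c - 1)], as a power series when
   [c = 0]. *)
Definition shifted_bin (c m : nat) : rat :=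
  match m, c with
  | 0, _ => 0
  | m'.+1, 0 => (- 1) ^+ m'
  | m'.+1, c'.+1 => 'C(c', m')%:R
  end.

Lemma shifted_binS (c m : nat) :
  shifted_bin c.+1 m.+1 = shifted_bin c m.+1 + shifted_bin c m.
Proof.
case: c m => [|c] [|m] /=; rewrite ?addr0 ?bin0 //.
  by rewrite bin0n exprS mulN1r addNr.
by rewrite binS natrD.
Qed.

(** Coefficientwise form of [z ((1 + z) ^ c)' = c z (1 + z) ^ (c - 1)]. *)
Lemma mul_shifted_bin (c m : nat) :
  m%:R * 'C(c, m)%:R = c%:R * shifted_bin c m.
Proof.
case: c m => [|c] [|m] /=; rewrite ?mul0r ?mulr0 ?bin0n ?mulr0 //.
by rewrite -!natrM -mul_bin_diag.
Qed.

(* Coefficient of [z ^ (|mu| + m)], at run content [mu], in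
   [P ^ M (1 + z) ^ c (1 - k z P' / P - d z / (1 + z))], where
   [P = 1 + \sum_i p_i z ^ i] marks a run of [i] east steps by [p_i]. *)
Definition prefix_count (k d M c : nat) (mu : seq nat) (m : nat) : rat :=
  fillings M mu
  * ('C(c, m)%:R * (1 - k%:R * ((sumn mu)%:R / M%:R)) - d%:R * shifted_bin c m).

(** Multiplication by [P]: one more run, empty or of some length [j] in [mu]. *)
Lemma prefix_count_runs (k d M c : nat) (mu : seq nat) (m : nat) :
  (0 < M)%N ->
  prefix_count k d M c mu m
    + \sum_(j <- undup mu) prefix_count k d M c (rem j mu) m
  = prefix_count k d M.+1 c mu m.
Proof.
move=> M_gt0; pose u : rat := 'C(c, m)%:R - d%:R * shifted_bin c m.
pose v : rat := 'C(c, m)%:R * k%:R.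
have split_count N nu : prefix_count k d N c nu m
    = u * fillings N nu - v * ((sumn nu)%:R / N%:R * fillings N nu).
  by rewrite /prefix_count /u /v; ring.
rewrite !split_count -(sum_fillings_weighted mu M_gt0) -sum_fillings.
rewrite !mulrDr !mulr_sumr opprD addrACA -sumrB; congr (_ + _).
apply: eq_big_seq => j; rewrite mem_undup => j_mu.
by rewrite split_count (perm_sumn (perm_to_rem j_mu)) /= addKn.
Qed.

(** Multiplication by [1 + z]: one more row where a diagonal step is optional. *)
Lemma prefix_count_diag (k d M c : nat) (mu : seq nat) (m : nat) :
  prefix_count k d M c mu m.+1 + prefix_count k d M c mu m
  = prefix_count k d M c.+1 mu m.+1.
Proof. by rewrite /prefix_count shifted_binS binS natrD; ring. Qed.

Lemma prefix_count_diag0 (k d M c : nat) (mu : seq nat) :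
  prefix_count k d M c mu 0 = prefix_count k d M c.+1 mu 0.
Proof. by rewrite /prefix_count !bin0. Qed.

(* Lagrange inversion in disguise: [z ^ X] has coefficient 0 in
   [phi ^ X (1 - z phi' / phi)] for [phi = P ^ k (1 + z) ^ d]. *)
Lemma prefix_count_below (k d X : nat) (mu : seq nat) (m : nat) :
  (0 < k)%N -> (0 < X)%N -> (sumn mu + m)%N = X ->
  prefix_count k d (k * X) (d * X) mu m = 0.
Proof.
move=> k_gt0 X_gt0 def_X; rewrite /prefix_count.
have k0: k%:R != 0 :> rat by rewrite pnatr_eq0 -lt0n.
have X0: X%:R != 0 :> rat by rewrite pnatr_eq0 -lt0n.
have -> : d%:R * shifted_bin (d * X) m = m%:R / X%:R * 'C(d * X, m)%:R.
  by rewrite mulrAC mul_shifted_bin natrM; field.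
have -> : (sumn mu)%:R = X%:R - m%:R :> rat by rewrite -def_X natrD addrK.
by rewrite natrM; field; rewrite k0 X0.
Qed.

Local Close Scope ring_scope.

(** * Decomposition of paths into rows *)

Lemma vertices_rcons w (s : step) :
  vertices (rcons w s) = rcons (vertices w) (move (endpoint w) s).
Proof. by rewrite /vertices scanl_rcons foldl_rcons. Qed.

Lemma endpoint_rcons w (s : step) : endpoint (rcons w s) = move (endpoint w) s.
Proof. by rewrite /endpoint foldl_rcons. Qed.

Lemma diag_starts_rcons w (s : step) :
  diag_starts (rcons w s)
  = diag_starts w ++ (if s == Diag then [:: endpoint w] else [::]).
Proof.
rewrite /diag_starts /vertices /endpoint.
elim: w (0, 0) => [|t w IHw] v /=; first by case: s.
by have /= := IHw (move v t); case: (t == Diag) => /= ->.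
Qed.

(** Leaving the test [good] on diagonal starts abstract lets large and small paths share one
    decomposition. *)
Definition admissible (k : nat) (good : pred (nat * nat)) (w : seq step) :=
  all (fun v => k * v.1 <= v.2) (vertices w) && all good (diag_starts w).

Lemma admissible_rcons k good w (s : step) :
  admissible k good (rcons w s)
  = [&& admissible k good w, (s == Diag) ==> good (endpoint w)
      & k * (endpoint (rcons w s)).1 <= (endpoint (rcons w s)).2].
Proof.
rewrite /admissible vertices_rcons diag_starts_rcons endpoint_rcons.
rewrite all_rcons all_cat -!andbA andbC -!andbA; do 2!congr andb.
by congr andb; case: (s == Diag); rewrite /= ?andbT.
Qed.

Definition row (s : step) (j : nat) : seq step := s :: nseq j East.

Lemma cat_rowS u s j : u ++ row s j.+1 = rcons (u ++ row s j) East.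
Proof.
rewrite rcons_cat; congr (_ ++ _ :: _).
by elim: j => //= j <-.
Qed.

Lemma cat_row0 u s : u ++ row s 0 = rcons u s.
Proof. by rewrite -cats1. Qed.

Lemma endpoint_row u (s : step) j :
  s != East ->
  endpoint (u ++ row s j)
  = ((endpoint u).1 + (s == Diag) + j, (endpoint u).2.+1).
Proof.
move=> sE; elim: j => [|j IHj].
  by rewrite cat_row0 endpoint_rcons addn0; case: s sE => //= _; rewrite ?addn0 ?addn1.
by rewrite cat_rowS endpoint_rcons IHj /= addnS.
Qed.

(* The last vertex of a row is its rightmost one, hence the only one to test. *)
Lemma admissible_row k good u (s : step) j :
  s != East ->
  admissible k good (u ++ row s j)
  = [&& admissible k good u, (s == Diag) ==> good (endpoint u)
      & k * ((endpoint u).1 + (s == Diag) + j) <= (endpoint u).2.+1].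
Proof.
move=> sE; elim: j => [|j IHj].
  by rewrite cat_row0 admissible_rcons -cat_row0 endpoint_row.
rewrite cat_rowS admissible_rcons IHj -cat_rowS !endpoint_row //=.
case: (admissible k good u) => //=; rewrite -andbA.
congr andb; rewrite andb_idl // => /(leq_trans _); apply.
by rewrite leq_mul2l addnS leqnSn orbT.
Qed.

Lemma east_runs_row c u (s : step) j :
  s != East -> east_runs c (u ++ row s j) = rcons (east_runs c u) j.
Proof.
move=> sE; have run i : east_runs i (nseq j East) = [:: i + j].
  by elim: j i => [|j IHj] i /=; rewrite ?addn0 // IHj addnS.
elim: u c => [|t u IHu] c; first by case: s sE => //= _; rewrite run.
by case: t => /=; rewrite IHu.
Qed.

Lemma count_diag_row u (s : step) j :
  count_mem Diag (u ++ row s j) = count_mem Diag u + (s == Diag).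
Proof. by rewrite count_cat /= count_nseq addn0. Qed.

Lemma last_row w :
  0 < (endpoint w).2 -> exists u (s : step) j, s != East /\ w = u ++ row s j.
Proof.
elim/last_ind: w => [//|w s IHw]; case: (eqVneq s East) => [->|sE] h.
  case: IHw => [|u [t [j [tE ->]]]]; first by move: h; rewrite endpoint_rcons.
  by exists u, t, j.+1; rewrite cat_rowS.
by exists w, s, 0; rewrite cat_row0.
Qed.

Lemma row_inj u (s : step) j u' (s' : step) j' :
  s != East -> s' != East ->
  u ++ row s j = u' ++ row s' j' -> [/\ u = u', s = s' & j = j'].
Proof.
move=> sE s'E; elim: j j' => [|j IHj] [|j'].
- by rewrite !cat_row0 => /rcons_inj[-> ->].
- by rewrite cat_row0 cat_rowS => /rcons_inj[_ eq_s]; rewrite eq_s in sE.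
- by rewrite cat_row0 cat_rowS => /rcons_inj[_ eq_s]; rewrite -eq_s in s'E.
by rewrite !cat_rowS => /rcons_inj[/IHj[-> -> ->]].
Qed.

Lemma endpoint_fst w :
  (endpoint w).1 = sumn (east_runs 0 w) + count_mem Diag w.
Proof.
rewrite /endpoint -[RHS](add0n).
(* The counter [c] of the open run stands for east steps already taken, hence its appearance on the
   left. *)
suff gen v c : (foldl move v w).1 + c
    = v.1 + (sumn (east_runs c w) + count_mem Diag w).
  by rewrite -(gen (0, 0) 0) addn0.
elim: w v c => [|s w IHw] v c; first by rewrite /= !addn0.
case: s => /=.
- by have := IHw (move v East) c.+1; rewrite /= => ?; lia.
- by have := IHw (move v North) 0; rewrite /= => ?; lia.
by have := IHw (move v Diag) 0; rewrite /= => ?; lia.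
Qed.

Lemma sumn_pos (s : seq nat) : sumn [seq r <- s | 0 < r] = sumn s.
Proof. by elim: s => [|[|r] s IHs] //=; rewrite IHs. Qed.

(** * Enumeration of prefixes by their last row *)

Definition is_prefix (k : nat) (good : pred (nat * nat)) (y : nat) (mu : seq nat)
    (m : nat) (w : seq step) : bool :=
  [&& admissible k good w, perm_eq [seq r <- east_runs 0 w | 0 < r] mu,
      count_mem Diag w == m & (endpoint w).2 == y].

Lemma prefix_endpoint k good y mu m w :
  is_prefix k good y mu m w -> endpoint w = (sumn mu + m, y).
Proof.
case/and4P=> _ /perm_sumn; rewrite sumn_pos => <- /eqP<- /eqP<-.
by rewrite -endpoint_fst -surjective_pairing.
Qed.

(** The value 0 encodes an empty last run; as [rem 0 mu = mu] when 0 is not in [mu], empty and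
    nonempty runs are treated uniformly. *)
Lemma perm_pos_rcons (s mu : seq nat) (j : nat) :
  0 \notin mu ->
  perm_eq [seq r <- rcons s j | 0 < r] mu
  = (j \in 0 :: undup mu) && perm_eq [seq r <- s | 0 < r] (rem j mu).
Proof.
move=> mu0; rewrite filter_rcons inE mem_undup; case: j => [|j] /=.
  by rewrite rem_id.
have [j_mu|j_mu] := boolP (j.+1 \in mu).
  rewrite (permPr (perm_to_rem j_mu)) -cats1.
  by rewrite perm_catC /= perm_cons.
by apply/negP => /perm_mem/(_ j.+1); rewrite mem_rcons inE eqxx (negPf j_mu).
Qed.

(** The run content and the number of diagonal steps of [u] force its endpoint, so the tests on the
    last row depend only on [mu], [m], [y], [j] and [s]. This is what makes a recursion on these
    data possible. *)
Lemma prefix_row k good y mu m u (s : step) j :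
  0 \notin mu -> s != East ->
  is_prefix k good y.+1 mu m (u ++ row s j)
  = [&& k * (sumn mu + m) <= y.+1, j \in 0 :: undup mu,
        (s == Diag) ==> (0 < m) && good (sumn (rem j mu) + m.-1, y)
      & is_prefix k good y (rem j mu) (m - (s == Diag)) u].
Proof.
move=> mu0 sE; apply/idP/idP.
  move=> w_ok; have := prefix_endpoint w_ok; rewrite endpoint_row // => -[x_u y_u].
  move: w_ok; rewrite /is_prefix admissible_row // east_runs_row //.
  rewrite perm_pos_rcons // count_diag_row.
  case/and4P=> /and3P[u_ok u_good lt_xy] /andP[j_mu u_mu] /eqP def_m _.
  rewrite -x_u -y_u lt_xy u_ok u_mu j_mu -def_m addnK !eqxx /= !andbT.
  have := endpoint_fst u; rewrite -(sumn_pos (east_runs 0 u)) (perm_sumn u_mu).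
  move=> def_x; apply: contraTT u_good; case: (s == Diag) => //=.
  rewrite addn1 /= -def_x (_ : (endpoint u).2 = y); last by case: y_u.
  by rewrite -{1}(_ : endpoint u = ((endpoint u).1, y)) // -y_u; case: endpoint.
case/and4P=> le_xy j_mu m_ok u_ok; have end_u := prefix_endpoint u_ok.
have sum_j : sumn (rem j mu) + j = sumn mu.
  move: j_mu; rewrite inE mem_undup; case/orP=> [/eqP->|j_mu].
    by rewrite rem_id // addn0.
  by rewrite (perm_sumn (perm_to_rem j_mu)) addnC.
case/and4P: u_ok => u_ok u_mu /eqP u_m _.
have def_m : m = m - (s == Diag) + (s == Diag).
  by rewrite subnK //; case: (s == Diag) m_ok => //= /andP[].
have def_x : sumn (rem j mu) + (m - (s == Diag)) + (s == Diag) + j = sumn mu + m.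
  by rewrite -sum_j [in RHS]def_m; ring.
rewrite /is_prefix admissible_row // east_runs_row // perm_pos_rcons //.
rewrite count_diag_row endpoint_row // u_ok j_mu u_mu u_m -def_m end_u /= !eqxx.
rewrite def_x le_xy !andbT; move: m_ok.
by case: (s == Diag) => //= /andP[_]; rewrite subn1.
Qed.

Fixpoint prefixes (k : nat) (good : pred (nat * nat)) (y : nat) (mu : seq nat)
    (m : nat) : seq (seq step) :=
  if y is y'.+1 then
    if k * (sumn mu + m) <= y then
      [seq u ++ row North j | j <- 0 :: undup mu,
                              u <- prefixes k good y' (rem j mu) m]
      ++ [seq u ++ row Diag j | j <- [seq j <- 0 :: undup mu |
                        (0 < m) && good (sumn (rem j mu) + m.-1, y')],
                                u <- prefixes k good y' (rem j mu) m.-1]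
    else [::]
  else if (mu == [::]) && (m == 0) then [:: [::]] else [::].

Lemma prefixesS k good y mu m :
  prefixes k good y.+1 mu m
  = if k * (sumn mu + m) <= y.+1 then
      [seq u ++ row North j | j <- 0 :: undup mu,
                              u <- prefixes k good y (rem j mu) m]
      ++ [seq u ++ row Diag j | j <- [seq j <- 0 :: undup mu |
                        (0 < m) && good (sumn (rem j mu) + m.-1, y)],
                                u <- prefixes k good y (rem j mu) m.-1]
    else [::].
Proof. by []. Qed.

Lemma notin_rem (mu : seq nat) i j : i \notin mu -> i \notin rem j mu.
Proof. by apply: contra; apply: mem_rem. Qed.

Lemma mem_prefixes k good y mu m w :
  0 < k -> 0 \notin mu -> (w \in prefixes k good y mu m) = is_prefix k good y mu m w.
Proof.
move=> k_gt0; elim: y mu m w => [|y IHy] mu m w mu0.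
  apply/idP/idP => [/=|w_ok].
    case: ifP => // /andP[/eqP-> /eqP->]; rewrite inE => /eqP->.
    by rewrite /is_prefix /admissible /= muln0.
  have := prefix_endpoint w_ok; case/and4P: w_ok => w_ok w_mu /eqP w_m _ end_w.
  (* At height 0 the endpoint can be weakly above [y = k x] only at the origin. *)
  have [x0 m0] : sumn mu = 0 /\ m = 0.
    have: k * (sumn mu + m) <= 0.
      case/andP: w_ok => /allP/(_ (endpoint w)) + _; rewrite end_w; apply.
      rewrite -end_w; case/lastP: (w) => [|w' s]; first by rewrite inE.
      by rewrite vertices_rcons endpoint_rcons mem_rcons mem_head.
    by nia.
  have mu_nil : mu = [::].
    by case: (mu) mu0 x0 => //= -[|i] mu'; rewrite ?inE ?eqxx //.
  have w_nil : w = [::].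
    apply/eqP; rewrite -size_eq0 -leqn0.
    by have := size_le_endpoint w (0, 0); rewrite -/(endpoint w) end_w x0 m0 /= !addn0.
  by rewrite /= mu_nil m0 w_nil.
rewrite prefixesS; apply/idP/idP => [|w_ok].
  case: ifP => // le_xy; rewrite mem_cat => /orP[] /allpairsPdep[j [u []]].
    move=> j_mu; rewrite IHy ?notin_rem // => u_ok ->.
    by rewrite prefix_row // le_xy j_mu subn0.
  rewrite mem_filter => /andP[m_ok j_mu].
  rewrite IHy ?notin_rem // => u_ok ->.
  by rewrite prefix_row // le_xy j_mu subn1 m_ok.
have [|u [s [j [sE def_w]]]] := @last_row w; first by rewrite (prefix_endpoint w_ok).
move: w_ok; rewrite def_w prefix_row // => /and4P[le_xy j_mu m_ok u_ok].
rewrite le_xy mem_cat; apply/orP; case: s sE m_ok u_ok {def_w} => // _ m_ok u_ok.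
  left; apply/allpairsPdep; exists j, u; split=> //.
  by rewrite IHy ?notin_rem // -[m]subn0.
right; apply/allpairsPdep; exists j, u; split=> //.
  by rewrite mem_filter; apply/andP.
by rewrite IHy ?notin_rem // -subn1.
Qed.

Lemma prefixes_uniq k good y mu m :
  0 \notin mu -> uniq (prefixes k good y mu m).
Proof.
elim: y mu m => [|y IHy] mu m mu0; first by rewrite /=; case: ifP.
rewrite prefixesS.
have uniq_j : uniq (0 :: undup mu) by rewrite /= mem_undup mu0 undup_uniq.
case: ifP => // _; rewrite cat_uniq.
have pairs_uniq (s : step) (r : seq nat) m' : s != East -> uniq r ->
    uniq [seq u ++ row s j | j <- r, u <- prefixes k good y (rem j mu) m'].
  move=> sE r_uniq; apply: allpairs_uniq_dep => //.
    by move=> j _; apply: IHy; apply: notin_rem.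
  by move=> [j u] [j' u'] _ _ /= /(row_inj sE sE)[-> _ ->].
rewrite !pairs_uniq ?filter_uniq // andbT.
apply/hasPn => w /allpairsPdep[j [u [_ _ ->]]].
by apply/negP => /allpairsPdep[j' [u' [_ _ /row_inj[]]]].
Qed.

(** * Counting prefixes *)

Lemma diag_level_periodic k (S : {fset nat}) X y :
  diag_level k S (k * X + y) = diag_level k S y.
Proof. by apply: eq_existsb => r; rewrite -addnS [k * X]mulnC modnMDl. Qed.

Lemma diag_level_lt k (S : {fset nat}) y :
  (forall r, r \in S -> 1 <= r <= k) -> y < k ->
  diag_level k S y = (y.+1 \in S).
Proof.
move=> S_le y_lt; apply/existsP/idP => [[r]|yS]; last by exists [` yS]%fset.
have /andP[r_gt0 r_le] := S_le _ (valP r).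
rewrite -(prednK r_gt0) -addn1 -[(val r).-1.+1]addn1 eqn_modDr.
rewrite !modn_small ?prednK // => /eqP->.
by rewrite addn1 prednK //; apply: valP.
Qed.

(** A diagonal step arriving at a height divisible by [k] has [r = k]; only such steps can end on
    the line, whence the role of [k \in S]. *)
Lemma diag_level_pred k (S : {fset nat}) X y :
  (forall r, r \in S -> 1 <= r <= k) -> y.+1 = k * X ->
  diag_level k S y = (k \in S).
Proof.
move=> S_le def_y; have /andP[k_gt0 X_gt0] : (0 < k) && (0 < X).
  by rewrite -muln_gt0 -def_y.
have -> : y = k * X.-1 + k.-1.
  by apply: succn_inj; rewrite def_y -addnS prednK // addnC -mulnS prednK.
by rewrite diag_level_periodic diag_level_lt // prednK.
Qed.

(** Each block of [k] consecutive heights has one allowed start [r - 1], modulo [k], for each [r] in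
    [S]. *)
Lemma count_diag_level k (S : {fset nat}) X :
  (forall r, r \in S -> 1 <= r <= k) ->
  count (diag_level k S) (iota 0 (k * X)) = #|` S| * X.
Proof.
move=> S_le; elim: X => [|X IHX]; first by rewrite !muln0.
rewrite !mulnS addnC iotaD count_cat IHX addnC add0n; congr (_ + _).
rewrite -[k * X]addn0 iotaDl count_map.
rewrite (eq_in_count (a2 := fun y => y.+1 \in S)); last first.
  move=> y; rewrite mem_iota /= => y_lt.
  by rewrite diag_level_periodic diag_level_lt.
rewrite -size_filter -(size_map succn); apply/perm_size/uniq_perm.
- by rewrite map_inj_uniq ?filter_uniq ?iota_uniq //; apply: succn_inj.
- exact: fset_uniq.
move=> r; apply/mapP/idP => [[y] | rS].
  by rewrite mem_filter => /andP[yS _] ->.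
have /andP[r_gt0 r_le] := S_le r rS.
by exists r.-1; rewrite ?prednK // mem_filter prednK // rS mem_iota prednK.
Qed.

(** [touch] is true for large paths and false for small ones. *)
Definition good_diag (k : nat) (S : {fset nat}) (touch : bool) (v : nat * nat) :=
  diag_level k S v.2
  && (touch || ~~ on_line k v && ~~ on_line k (move v Diag)).

(* A diagonal step which starts on the line [y = k x] and stays weakly above it
   must have [k = 1], hence also ends on the line. *)
Lemma good_diagE k (S : {fset nat}) touch x y :
  0 < k -> k * x.+1 <= y.+1 ->
  good_diag k S touch (x, y)
  = diag_level k S y && (touch || (y.+1 != k * x.+1)).
Proof.
move=> k_gt0 le_xy; rewrite /good_diag /on_line /=; congr (_ && (_ || _)).
by rewrite andb_idl // => ne_xy; apply: contra ne_xy => /eqP def_y; nia.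
Qed.

Lemma prefixes_below k good y mu m :
  0 < k -> y < k * (sumn mu + m) -> prefixes k good y mu m = [::].
Proof.
move=> k_gt0; case: y => [|y] lt_y; last by rewrite prefixesS leqNgt lt_y.
rewrite /=; case: ifP => // /andP[/eqP mu0 /eqP m0].
by rewrite mu0 m0 muln0 in lt_y.
Qed.

Lemma size_prefixesS k good y mu m :
  k * (sumn mu + m) <= y.+1 ->
  size (prefixes k good y.+1 mu m)
  = \sum_(j <- 0 :: undup mu) size (prefixes k good y (rem j mu) m)
    + \sum_(j <- 0 :: undup mu | (0 < m) && good (sumn (rem j mu) + m.-1, y))
        size (prefixes k good y (rem j mu) m.-1).
Proof.
move=> le_xy; rewrite prefixesS le_xy size_cat !size_allpairs_dep !sumnE.
by rewrite !big_map big_filter.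
Qed.

Local Open Scope ring_scope.

Lemma size_prefixes k (S : {fset nat}) touch y mu m :
  (0 < k)%N -> (forall r, r \in S -> (1 <= r <= k)%N) ->
  touch || (k \in S) -> 0%N \notin mu -> (k * (sumn mu + m) <= y)%N ->
  (size (prefixes k (good_diag k S touch) y mu m))%:R
  = prefix_count k #|` S| y.+1
      (count (diag_level k S) (iota 0 y) + (touch && (k \in S))) mu m.
Proof.
move=> k_gt0 S_le touch_kS; set good := good_diag k S touch; set d := #|` S|.
elim: y mu m => [|y IHy] mu m mu0 le_xy.
  have [x0 ->] : (sumn mu = 0 /\ m = 0)%N by nia.
  have -> : mu = [::].
    by case: (mu) mu0 x0 => //= -[|i] mu'; rewrite ?inE ?eqxx.
  rewrite /prefix_count /fillings /mult_fact /= big_nil bin0 ffactn0.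
  by field.
have -> : count (diag_level k S) (iota 0 y.+1)
    = (count (diag_level k S) (iota 0 y) + diag_level k S y)%N.
  by rewrite -addn1 iotaD count_cat /= addn0.
rewrite size_prefixesS // natrD !natr_sum addnAC.
set c := (count _ _ + _)%N; set a := diag_level k S y.
have rem_lt j : j \in undup mu -> (sumn (rem j mu) < sumn mu)%N.
  rewrite mem_undup => j_mu; rewrite (perm_sumn (perm_to_rem j_mu)) /=.
  by rewrite -addn1 addnC leq_add2r lt0n; apply: contraNneq mu0 => <-.
(* Removing a run of length [j >= 1] lowers the abscissa, so the induction hypothesis applies even
   when the row ends on the line. *)
have runs p : (k * (sumn mu + p) <= y.+1)%N ->
    \sum_(j <- undup mu) (size (prefixes k good y (rem j mu) p))%:R
    = prefix_count k d y.+2 c mu p - prefix_count k d y.+1 c mu p.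
  move=> le_p; rewrite -(prefix_count_runs k d c mu p (ltn0Sn y)) addrC addKr.
  apply: eq_big_seq => j /rem_lt lt_j; apply: IHy; first exact: notin_rem.
  by nia.
have head p : (k * (sumn mu + p) <= y)%N ->
    (size (prefixes k good y mu p))%:R = prefix_count k d y.+1 c mu p.
  exact: IHy.
(* A diagonal step followed by a nonempty run ends strictly left of an allowed vertex of the same
   height, hence off the line: [touch] does not matter here. *)
have diag_runs :
    \sum_(j <- undup mu | (0 < m)%N && good ((sumn (rem j mu) + m.-1)%N, y))
       (size (prefixes k good y (rem j mu) m.-1))%:R
    = if a && (0 < m)%N then
        prefix_count k d y.+2 c mu m.-1 - prefix_count k d y.+1 c mu m.-1
      else 0.
  case: {+}m le_xy => [|p] le_xy /=; first by rewrite big_pred0_eq andbF.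
  rewrite andbT big_seq_cond (eq_bigl (fun j => (j \in undup mu) && a)).
    rewrite -big_seq_cond; case: a; last by rewrite big_pred0_eq.
    by apply: runs; nia.
  move=> j; apply: andb_id2l => /rem_lt lt_j.
  rewrite /good good_diagE //; last by nia.
  by rewrite -/a neq_ltn [X in _ || (_ || X)](_ : _ = true) ?orbT ?andbT //; nia.
rewrite !big_cons rem_id // runs // diag_runs.
(* If the row ends off the line, the terms with an empty last run also follow the closed form, and
   the differences telescope. *)
have [le_y|gt_y] := leqP (k * (sumn mu + m)) y.
  rewrite head //; case: {+}m le_y => [|p] le_y /=.
    by case: (a) => /=; rewrite ?addn0 ?addn1 -?prefix_count_diag0 addr0 addrC subrK.
  rewrite /good good_diagE ?addnS // 1?neq_ltn; last by nia.
  rewrite [X in a && (_ || (_ || X))](_ : _ = true) ?orbT ?andbT; last by nia.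
  case: (a) => /=; last by rewrite addn0; ring.
  by rewrite head ?addn1 -?prefix_count_diag; [ring | nia].
have def_y : y.+1 = (k * (sumn mu + m))%N by apply/eqP; rewrite eqn_leq gt_y.
have aE : a = (k \in S) by apply: (diag_level_pred S_le def_y).
(* On the line at abscissa [X], the exponents are [k X] and [d X]: this is the vanishing case. *)
have zero : prefix_count k d y.+1 (count (diag_level k S) (iota 0 y) + a) mu m = 0.
  have -> : (count (diag_level k S) (iota 0 y) + a)%N = (d * (sumn mu + m))%N.
    by rewrite -(count_diag_level _ S_le) -def_y -addn1 iotaD count_cat /= addn0.
  rewrite def_y; apply: prefix_count_below => //.
  by move: def_y; case: (sumn mu + m)%N => //; rewrite muln0.
rewrite (@prefixes_below k good y mu m) //= add0r.
case: m {le_xy IHy runs diag_runs gt_y} def_y zero head => [|p] def_y zero head /=.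
  rewrite andbF addr0; move: zero; rewrite /c.
  case: (a); case: (touch && _) => /=; rewrite ?addn0 ?addn1 -?prefix_count_diag0;
  by move=> ->; rewrite subr0.
rewrite head; last by nia.
rewrite andbT /good good_diagE -?addnS -?def_y // -/a eqxx orbF.
move: zero touch_kS; rewrite /c -aE.
(* A north step with empty run is impossible here. With [k \in S] and touching allowed, its formal
   contribution is zero by itself; with touching forbidden, it cancels that of the excluded diagonal
   step; with [k \notin S], it is again zero by itself. *)
case: (a); case: (touch) => //= + _; rewrite ?addn0 ?addn1.
- move=> zero; rewrite zero.
  by rewrite subr0 [X in _ + X]addrC subrK prefix_count_diag.
- by rewrite -!prefix_count_diag => zero; rewrite addrACA -opprD zero subr0.
by move=> ->; rewrite subr0 addr0.
Qed.

(** * From prefixes to paths of given length and type *)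

Lemma num_pathsE k n (P : pred (seq step)) (s : seq (seq step)) :
  uniq s -> (forall w, P w = (w \in s)) ->
  (forall w, P w -> (size w <= n + k * n)%N) ->
  num_paths k n P = size s.
Proof.
move=> s_uniq Ps size_P; rewrite /num_paths cardE -(size_map val).
apply/perm_size/uniq_perm => //.
  by rewrite map_inj_uniq ?enum_uniq //; apply: val_inj.
move=> w; rewrite -Ps; apply/mapP/idP => [[v]|Pw].
  by rewrite mem_enum inE => Pv ->.
by exists (Bseq (size_P w Pw)); rewrite ?mem_enum ?inE.
Qed.

Local Close Scope ring_scope.

Lemma path_typeE w lam :
  is_partition lam ->
  (path_type w == lam) = perm_eq [seq r <- east_runs 0 w | 0 < r] lam.
Proof.
case/andP=> lam_sorted _.
have geq_trans : transitive geq by move=> y x z /= le_yx /leq_trans; apply.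
have geq_total : total geq by move=> x y; apply: leq_total.
have geq_anti : antisymmetric geq by move=> x y /anti_leq.
rewrite -{1}(sorted_sort geq_trans lam_sorted).
by apply/eqP/(perm_sortP geq_total geq_trans geq_anti).
Qed.

Lemma large_pathE k S n w :
  large_path k S n w
  = (endpoint w == (n, k * n)) && admissible k (good_diag k S true) w.
Proof.
rewrite /large_path /admissible; do 2!congr andb.
by apply: eq_all => v; rewrite /good_diag andbT.
Qed.

Lemma small_pathE k S n w :
  small_path k S n w
  = (endpoint w == (n, k * n)) && admissible k (good_diag k S false) w.
Proof. by rewrite /small_path /large_path /admissible -!andbA -all_predI. Qed.

(** The abscissa [n] is [|lam|] plus the number of diagonal steps, so length and type determine the
    latter. *)
Lemma prefix_of_length k good n y lam w :
  [&& endpoint w == (n, y), admissible k good w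
    & perm_eq [seq r <- east_runs 0 w | 0 < r] lam]
  = (sumn lam <= n) && is_prefix k good y lam (n - sumn lam) w.
Proof.
apply/idP/idP => [|/andP[le_n w_ok]]; last first.
  rewrite (prefix_endpoint w_ok) subnKC // eqxx /=.
  by case/and4P: w_ok => -> ->.
case/and3P=> /eqP end_w w_ok w_lam; rewrite /is_prefix w_ok w_lam end_w eqxx /=.
have := endpoint_fst w; rewrite end_w -(sumn_pos (east_runs 0 w)).
by rewrite (perm_sumn w_lam) /= => ->; rewrite leq_addr addKn eqxx.
Qed.

Lemma prefix_size k good n lam w :
  sumn lam <= n -> is_prefix k good (k * n) lam (n - sumn lam) w ->
  size w <= n + k * n.
Proof.
move=> le_n w_ok; have := size_le_endpoint w (0, 0).
by rewrite -/(endpoint w) (prefix_endpoint w_ok) subnKC //= !addn0.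
Qed.

Local Open Scope ring_scope.

Lemma num_paths_type k n (S : {fset nat}) touch lam (P : pred (seq step)) :
  (0 < k)%N -> (forall r, r \in S -> (1 <= r <= k)%N) ->
  touch || (k \in S) -> is_partition lam ->
  (forall w, P w = (endpoint w == (n, (k * n)%N))
                   && admissible k (good_diag k S touch) w) ->
  (num_paths k n (fun w => P w && (path_type w == lam)))%:R
  = if (sumn lam <= n)%N then
      prefix_count k #|` S| (k * n).+1 (#|` S| * n + (touch && (k \in S)))
        lam (n - sumn lam)
    else 0.
Proof.
move=> k_gt0 S_le touch_kS lam_part PE; have /andP[_ lam0] := lam_part.
set good := good_diag k S touch in PE *; set N := sumn lam.
have QE w : P w && (path_type w == lam)
    = (N <= n)%N && is_prefix k good (k * n) lam (n - N) w.
  by rewrite -prefix_of_length PE path_typeE // -andbA.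
have [le_Nn|gt_Nn] := leqP N n.
  rewrite (@num_pathsE _ _ _ (prefixes k good (k * n) lam (n - N))).
  - by rewrite size_prefixes ?subnKC // count_diag_level.
  - exact: prefixes_uniq.
  - by move=> w; rewrite QE le_Nn mem_prefixes.
  by move=> w; rewrite QE => /andP[_]; apply: prefix_size.
rewrite (@num_pathsE _ _ _ [::]) // => w; rewrite QE leqNgt gt_Nn //.
Qed.

Lemma num_paths_ends_diag k n (S : {fset nat}) lam :
  (0 < k)%N -> (0 < n)%N -> (forall r, r \in S -> (1 <= r <= k)%N) ->
  k \in S -> is_partition lam ->
  (num_paths k n
     (fun w => [&& large_path k S n w, path_type w == lam & ends_diag w]))%:R
  = if (sumn lam < n)%N then
      prefix_count k #|` S| (k * n) (#|` S| * n) lam (n - (sumn lam).+1)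
    else 0.
Proof.
move=> k_gt0 n_gt0 S_le kS lam_part; have /andP[_ lam0] := lam_part.
set good := good_diag k S true; set N := sumn lam.
have def_y : (k * n).-1.+1 = (k * n)%N by rewrite prednK // muln_gt0 k_gt0.
have QE w : [&& large_path k S n w, path_type w == lam & ends_diag w]
    = [&& (N <= n)%N, is_prefix k good (k * n) lam (n - N) w & ends_diag w].
  by rewrite andbA andbA -prefix_of_length large_pathE path_typeE // -!andbA.
(* A final diagonal step is a last row with empty run; deleting it leaves a prefix of height
   [k n - 1] with one diagonal step fewer and the same runs. *)
have RE u : is_prefix k good (k * n) lam (n - N) (rcons u Diag)
    = (N < n)%N && is_prefix k good (k * n).-1 lam (n - N.+1) u.
  rewrite -cat_row0 -def_y prefix_row // rem_id // def_y inE eqxx /= subn_gt0.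
  rewrite -subnDA addn1; case: ltnP => [lt_Nn|//]; last by rewrite andbF.
  have def_x : (sumn lam + (n - N).-1).+1 = n.
    by rewrite -/N -subnS -addnS subnSK // subnKC // ltnW.
  rewrite -/N subnKC ?(ltnW lt_Nn) // leqnn /good good_diagE // def_x def_y //.
  by rewrite (diag_level_pred S_le def_y) kS.
pose s := [seq rcons u Diag | u <-
             if (N < n)%N then prefixes k good (k * n).-1 lam (n - N.+1) else [::]].
rewrite (@num_pathsE _ _ _ s).
- rewrite size_map; case: ltnP => [lt_Nn|//].
  have le_y : (k * (sumn lam + (n - N.+1)) <= (k * n).-1)%N.
    by rewrite -/N; nia.
  rewrite size_prefixes //.
  rewrite def_y; congr (prefix_count _ _ _ _ _ _).
  (* The missing start height [k n - 1], allowed since [k \in S], is compensated by the extra row 0,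
     so the exponent is [d n]. *)
  rewrite -(count_diag_level n S_le) -[in RHS]def_y -[_.-1.+1]addn1 iotaD count_cat.
  by rewrite /= addn0 (diag_level_pred S_le def_y).
- rewrite map_inj_uniq; last by move=> u v /rcons_inj[].
  by case: ifP => // _; apply: prefixes_uniq.
- move=> w; rewrite QE; apply/and3P/mapP => [[le_Nn w_ok]|[u u_in ->]].
    case/lastP: w w_ok => [//|u t] w_ok; rewrite /ends_diag last_rcons => /eqP t_D.
    exists u; last by rewrite t_D.
    by move: w_ok; rewrite t_D RE => /andP[-> ?]; rewrite mem_prefixes.
  rewrite RE /ends_diag last_rcons; case: ltnP u_in => // lt_Nn.
  by rewrite mem_prefixes // => ->; rewrite ltnW.
by move=> w; rewrite QE => /and3P[le_Nn w_ok _]; apply: prefix_size w_ok.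
Qed.

Lemma fillings_bin M mu :
  fillings M mu
  = 'C(M, size mu)%:R * ((size mu)`!%:R / (mult_fact mu)%:R).
Proof. by rewrite /fillings -bin_ffact natrM mulrA. Qed.

Lemma binz_subn a n N :
  binz a (n%:Z - N%:Z) = if (N <= n)%N then 'C(a, n - N) else 0%N.
Proof.
case: leqP => [le_Nn | lt_nN]; first by rewrite subzn.
by rewrite -opprB subzn 1?ltnW // -(subnSK lt_nN).
Qed.

Local Close Scope ring_scope.

Theorem mainTheorem4 (k n : nat) (S : {fset nat}) (lam : seq nat) :
  1 <= k -> 1 <= n ->
  (forall r, r \in S -> 1 <= r <= k) ->
  is_partition lam ->
  let d := #|` S| in
  let l := size lam in
  let N := sumn lam in
  let c : rat := (l`!%:R / (mult_fact lam)%:R)%R in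
  let q : rat :=
    (1 / n%:R * (N%:R / (k * n + 1)%:R)
       * (binz (d * n) (n%:Z - N%:Z))%:R * 'C(k * n + 1, l)%:R * c)%R in
  (k \notin S ->
     ((num_paths k n
         (fun w => large_path k S n w && (path_type w == lam)))%:R = q)%R) /\
  (k \in S ->
     [/\ ((num_paths k n
             (fun w => small_path k S n w && (path_type w == lam)))%:R = q)%R,
         ((num_paths k n
             (fun w => [&& large_path k S n w, path_type w == lam
                         & ends_diag w]))%:R
          = 1 / n%:R * (binz (d * n) (n%:Z - 1 - N%:Z))%:R
              * 'C(k * n, l)%:R * c)%R
       & ((num_paths k n
             (fun w => large_path k S n w && (path_type w == lam)))%:R
          = 1 / n%:R
              * ((binz (d * n) (n%:Z - 1 - N%:Z))%:R
                 + N%:R / (k * n + 1)%:R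
                   * (binz (d * n + 1) (n%:Z - N%:Z))%:R)
              * 'C(k * n + 1, l)%:R * c)%R]).
Proof.
move=> k_gt0 n_gt0 S_le lam_part d l N c q.
have n0 : (n%:R != 0 :> rat)%R by rewrite pnatr_eq0 -lt0n.
have k0 : (k%:R != 0 :> rat)%R by rewrite pnatr_eq0 -lt0n.
have M0 : (k%:R * n%:R + 1 != 0 :> rat)%R.
  by rewrite -natrM natr1 pnatr_eq0.
(* Large paths with [k \notin S] and small paths with [k \in S] both lack the row 0, hence share the
   exponent [d n]. The bracket then is [1 - k N / (k n + 1) - (n - N) / n = N / (n (k n + 1))]. *)
have num_q touch : touch && (k \in S) = false ->
    (if N <= n then prefix_count k d (k * n).+1 (d * n + (touch && (k \in S)))
                      lam (n - N) else 0%R) = q.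
  move=> ->; rewrite addn0 /q binz_subn; case: leqP => [le_Nn|_]; last by ring.
  rewrite /prefix_count -addn1 fillings_bin -/c -/l -/N.
  have -> : (d%:R * shifted_bin (d * n) (n - N)
             = (n - N)%:R / n%:R * 'C(d * n, n - N)%:R)%R.
    by rewrite mulrAC mul_shifted_bin natrM; field.
  by rewrite natrB // natrD natrM; field; rewrite n0 M0.
split=> [kS | kS].
  rewrite (@num_paths_type _ _ S true) ?num_q //; first exact/negbTE.
  exact: large_pathE.
split.
- rewrite (@num_paths_type _ _ S false) ?num_q //; exact: small_pathE.
- rewrite num_paths_ends_diag // -/N -/d.
  rewrite (_ : (n%:Z - 1 - N%:Z = n%:Z - N.+1%:Z)%R); last by lia.
  rewrite binz_subn; case: ltnP => [lt_Nn|_]; last by ring.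
  rewrite /prefix_count fillings_bin -/c -/l -/N.
  (* Here the bracket reduces to [1 - N / n - (n - N - 1) / n = 1 / n]. *)
  have -> : (d%:R * shifted_bin (d * n) (n - N.+1)
             = (n - N.+1)%:R / n%:R * 'C(d * n, n - N.+1)%:R)%R.
    by rewrite mulrAC mul_shifted_bin natrM; field.
  by rewrite natrB // natrM -natr1; field; rewrite k0 n0.
rewrite (@num_paths_type _ _ S true) //; last exact: large_pathE.
rewrite kS /= -/N -/d (_ : (n%:Z - 1 - N%:Z = n%:Z - N.+1%:Z)%R); last by lia.
rewrite !binz_subn; case: (leqP N n) => [le_Nn|lt_nN]; last first.
  by rewrite [N < n]ltnNge (ltnW lt_nN) /=; ring.
rewrite /prefix_count -addn1 fillings_bin -/c -/l -/N.
have d0 : (d%:R * n%:R + 1 != 0 :> rat)%R.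
  by rewrite -natrM natr1 pnatr_eq0.
(* With the row 0 present the exponent is [d n + 1], and the first binomial of the total is its
   shifted coefficient; both vanish at [N = n]. *)
have -> : ((if N < n then 'C(d * n, n - N.+1) else 0)%N%:R
           = shifted_bin (d * n + 1) (n - N))%R.
  rewrite addn1; case: ltnP => [lt_Nn|le_nN]; first by rewrite -(subnSK lt_Nn).
  by rewrite (eqP (_ : n - N == 0)) // subn_eq0.
have -> : (shifted_bin (d * n + 1) (n - N)
           = (n - N)%:R * 'C(d * n + 1, n - N)%:R / (d%:R * n%:R + 1))%R.
  by rewrite mul_shifted_bin natrD natrM; field.
by rewrite natrB // natrD natrM; field; rewrite n0 M0 d0.
Qed.
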